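(* Let $1<q\leq\frac{2+\ln(2)}{2-\ln(2)}$ and let $q'=\frac{q}{q-1}$. The minimal constant $C_1(q)>0$ for which $$\sum_{n=1}^\infty a_n\leq C_1(q)\sum_{n=1}^\infty\left(\frac{1}{n}\sum_{k=n}^\infty a_k^q\right)^{\frac{1}{q}}$$ holds for all sequences $(a_n)_{n\in\mathbb{N}}\in\ell_q$ of nonnegative real numbers is at most $$\left(\frac{e\ln(2)}{\sqrt{2}}\right)^{\frac{1}{q'}}.$$
   Context: $\mathbb{N}=\{1,2,3,\ldots\}$. Sums of nonnegative terms take values in $[0,\infty]$. $e$ is Euler's number. $\ell_q$ is the space of sequences $(a_n)_{n\in\mathbb{N}}$ with $\sum_n |a_n|^q<\infty$. *)

(* Defs.v *)
From HB Require Import structures.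
From mathcomp Require Import all_boot all_order all_algebra.
From mathcomp Require Import all_classical all_reals all_analysis.

Set Implicit Arguments.
Unset Strict Implicit.
Unset Printing Implicit Defensive.

Import Order.TTheory GRing.Theory Num.Theory.
Import numFieldNormedType.Exports.

Local Open Scope classical_set_scope.
Local Open Scope ring_scope.

(* Sequences are indexed by n >= 1: a function a : nat -> R represents
   (a 1, a 2, ...), and the value a 0 is never used. *)

Definition in_ell (R : realType) (q : R) (a : nat -> R) : Prop :=
  (\sum_(1 <= n <oo) (`|a n| `^ q)%:E < +oo)%E.

(* The series take values in [0, +oo], whence the extended reals; for C > 0,
   C%:E * +oo = +oo. *)
Definition tail_inequality (R : realType) (q C : R) (a : nat -> R) : Prop :=
  (\sum_(1 <= n <oo) (a n)%:E <=
   C%:E * \sum_(1 <= n <oo)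
     ((n%:R^-1)%:E * \sum_(n <= k <oo) (a k `^ q)%:E) `^ q^-1)%E.

Definition admissible_constants (R : realType) (q : R) : set R :=
  [set C | 0 < C /\
     forall a : nat -> R, (forall n, (1 <= n)%N -> 0 <= a n) ->
       in_ell q a -> tail_inequality q C a].

Definition is_minimal_constant (R : realType) (q C : R) : Prop :=
  admissible_constants q C /\ lbound (admissible_constants q) C.

(* Main.v *)
Require Import Defs.
From HB Require Import structures.
From mathcomp Require Import all_boot all_order all_algebra.
From mathcomp Require Import all_classical all_reals all_analysis.
From mathcomp Require Import ring lra.

Set Implicit Arguments.
Unset Strict Implicit.
Unset Printing Implicit Defensive.

Import Order.TTheory GRing.Theory Num.Theory.
Import numFieldNormedType.Exports.

Local Open Scope classical_set_scope.
Local Open Scope ring_scope.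

(** Write p for q', so that 1/q + 1/p = 1, and let T_n be the tail sum of a_k^q
    over k >= n.  The n-th term on the right-hand side is
    n^(-1/q) T_n^(1/q), and T_n = a_n^q + T_(n+1).  For any B >= 0, Hoelder's
    inequality for two terms gives

      a_n + B^(1/p) T_(n+1)^(1/q) <= (B + 1)^(1/p) T_n^(1/q).

    Hence, if nonnegative numbers B_0 = 0, B_1, B_2, ... satisfy

      (B_n + 1)^(1/p) <= B_(n-1)^(1/p) + K^(1/p) n^(1/p - 1)   for n >= 1,

    then induction on N gives

      a_1 + ... + a_N + B_N^(1/p) T_(N+1)^(1/q)
        <= K^(1/p) * (sum over n <= N of n^(-1/q) T_n^(1/q)),

    and K^(1/p) is an admissible constant ([partial_sum_bound]).

    The bound on q says exactly that 1/p <= 2 ln 2 / (2 + ln 2), which is at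
    most 14/27 because ln 2 <= 7/10.  For all these p at once, K = 13/10 and
    B_n = (4n - 1)/10 satisfy the recursion ([weight_step]).  Put y = 1/p.
    For n = 1 the recursion is an equality.  For n >= 2, division by
    (B_n + 1)^y turns it into f(y) >= 1 for f(y) = r^y + s^y / n, with r and s
    positive and independent of y.  Since f is convex, f(0) = 1 + 1/n and f(1) <= 1, the single estimate
    f(1/2) >= 1 + 1/(28 n) propagates to all y in (0, 14/27]
    ([two_powers_ge1]), and that estimate only involves square roots
    ([sqrt_weights_ge]).

    Finally 13/10 <= e ln 2 / sqrt 2 ([constant_ge]).  The minimal constant
    itself is the infimum of the admissible ones: this infimum is at least 1,
    as the sequence (1, 0, 0, ...) shows, and the inequality passes to it. *)

(** * Numerical bounds *)

Lemma expR_ge_partial_sum (R : realType) (x : R) (m : nat) :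
  0 <= x -> \sum_(0 <= i < m) x ^+ i / i`!%:R <= expR x.
Proof.
move=> x0; apply: (@nondecreasing_cvgn_le _ (series (exp_coeff x))).
  apply/nondecreasing_seqP => n.
  by rewrite /series /= big_nat_recr//= lerDl exp_coeff_ge0.
exact: is_cvg_series_exp_coeff.
Qed.

Lemma ln2_le (R : realType) : ln 2 <= 7 / 10 :> R.
Proof.
rewrite -ler_expR lnK ?posrE ?ltr0n//.
have /(@expR_ge_partial_sum R _ 4) : 0 <= 7 / 10 :> R by lra.
apply: le_trans.
rewrite !big_nat_recr//= big_nil !exprS expr0 !factS fact0 !mul1n; lra.
Qed.

(** Equivalently exp(-2/3) >= 1/2, which follows from exp(-1/24) >= 23/24 by
    squaring four times and rounding down each time. *)
Lemma ln2_ge (R : realType) : 2 / 3 <= ln 2 :> R.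
Proof.
have double (x x' y : R) : 0 <= x -> x' <= x ^+ 2 -> x <= expR (- y) ->
    x' <= expR (- (2 * y)).
  move=> x0 xx xy; apply: le_trans xx _.
  by rewrite mulr_natl -mulNrn mulr2n expRD -expr2 lerXn2r// nnegrE expR_ge0.
have h1 : 23 / 24 <= expR (- (1 / 24)) :> R.
  by apply: le_trans (expR_ge1Dx _); lra.
have h2 : 918 / 1000 <= expR (- (2 * (1 / 24))) :> R.
  by apply: double h1; rewrite ?expr2; lra.
have h4 : 842 / 1000 <= expR (- (2 * (2 * (1 / 24)))) :> R.
  by apply: double h2; rewrite ?expr2; lra.
have h8 : 708 / 1000 <= expR (- (2 * (2 * (2 * (1 / 24))))) :> R.
  by apply: double h4; rewrite ?expr2; lra.
have : 2^-1 <= expR (- (2 * (2 * (2 * (2 * (1 / 24)))))) :> R.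
  by apply: double h8; rewrite ?expr2; lra.
rewrite expRN lef_pV2 ?posrE ?expR_gt0 ?ltr0n// => h.
rewrite -ler_expR lnK ?posrE ?ltr0n//; apply: le_trans h.
by rewrite ler_expR; lra.
Qed.

(** Since e = 2 exp(1 - ln 2), the quantity e ln 2 equals 2x exp(1 - x) at
    x = ln 2; the quadratic Taylor bound of exp(1 - x) makes the rough estimate
    x >= 2/3 precise enough, whereas bounding e and ln 2 separately would need
    sharper numerics. *)
Lemma constant_ge (R : realType) : 13 / 10 <= expR 1 * ln 2 / Num.sqrt 2 :> R.
Proof.
have s2 : Num.sqrt 2 <= 71 / 50 :> R.
  have p0 : 0 <= 71 / 50 :> R by lra.
  by rewrite -(ger0_norm p0) -sqrtr_sqr ler_wsqrtr// expr2; lra.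
have s0 : 0 < Num.sqrt 2 :> R by rewrite sqrtr_gt0 ltr0n.
rewrite ler_pdivlMr//.
have x1 := ln2_ge R; have x2 := ln2_le R.
set x := ln 2 in x1 x2 *.
have -> : expR 1 = 2 * expR (1 - x) :> R.
  by rewrite -[X in X * _](@lnK R) ?posrE ?ltr0n// -expRD subrKC.
have : 1 + (1 - x) + (1 - x) ^+ 2 / 2 <= expR (1 - x).
  have /(@expR_ge_partial_sum R _ 3) : 0 <= 1 - x by lra.
  apply: le_trans; rewrite !big_nat_recr//= big_nil expr0 expr1 !factS fact0 !mul1n.
  by rewrite le_eqVlt; apply/orP; left; apply/eqP; field.
set E := expR _; rewrite expr2 => hE.
(* The value at x = 2/3 of the lower bound 2x(1 + (1 - x) + (1 - x)^2 / 2),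
   which increases with x. *)
have : 13 / 10 * (71 / 50) <= 2 * (4 / 3 + 1 / 18) * (2 / 3) :> R by lra.
nra.
Qed.

(** * The recursion for the weights *)

Lemma powR_convex_exponent (R : realType) (x u v t : R) :
  0 < x -> 0 <= t <= 1 ->
  x `^ (t * u + (1 - t) * v) <= t * x `^ u + (1 - t) * x `^ v.
Proof.
move=> x0 /andP[t0 t1].
have := convex_expR (Itv01 t0 t1) (u * ln x) (v * ln x).
by rewrite !convRE/= !mulrA -mulrDl /powR gt_eqF.
Qed.

(** The estimate f(1/2) >= 1 + 1/(28 n), with the values of r and s that
    B_n = (4n - 1)/10 and K = 13/10 produce. *)
Lemma sqrt_weights_ge (R : realType) (n : R) : 2 <= n ->
  1 + 1 / 28 / n <=
  Num.sqrt ((4 * n - 5) / (4 * n + 9)) + Num.sqrt (13 * n / (4 * n + 9)) / n.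
Proof.
move=> n2; have n0 : 0 < n by lra.
have m0 : 0 < 4 * n + 9 by lra.
set r := (4 * n - 5) / _; set s := 13 * n / _.
have r0 : 0 <= r by rewrite divr_ge0//; lra.
have s0 : 0 <= s by rewrite divr_ge0//; lra.
(* A rational minorant of sqrt (r * s), whose numerator has slope 143/20, just
   below the asymptotic slope sqrt 52: it bounds the square of the right-hand
   side below by a rational function. *)
have w0 : 0 <= (143 / 20 * n - 61 / 10) / (4 * n + 9).
  by rewrite divr_ge0//; lra.
have uv : (143 / 20 * n - 61 / 10) / (4 * n + 9) <= Num.sqrt r * Num.sqrt s.
  rewrite -sqrtrM// -(ger0_norm w0) -sqrtr_sqr ler_wsqrtr//.
  rewrite /r /s mulf_div expr_div_n -expr2.
  by rewrite ler_pM2r ?invr_gt0 ?exprn_gt0// !expr2; nra.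
have c0 : 0 <= 1 + 1 / 28 / n by rewrite addr_ge0 ?divr_ge0// ltW.
have d0 : 0 <= Num.sqrt r + Num.sqrt s / n.
  by rewrite addr_ge0 ?divr_ge0 ?sqrtr_ge0// ltW.
suff : (1 + 1 / 28 / n) ^+ 2 <= (Num.sqrt r + Num.sqrt s / n) ^+ 2.
  by rewrite ler_pXn2r.
apply: (@le_trans _ _ (r + s / n ^+ 2 +
    2 * ((143 / 20 * n - 61 / 10) / (4 * n + 9)) / n)).
  rewrite -subr_ge0 /r /s.
  rewrite [X in 0 <= X](_ : _ =
    (n ^+ 2 / 70 + 149 / 980 * n - 9 / 784) / (n ^+ 2 * (4 * n + 9))).
    have q0 : 0 <= n ^+ 2 by rewrite exprn_ge0// ltW.
    by apply: divr_ge0; [lra | exact: mulr_ge0 q0 (ltW m0)].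
  by field; rewrite !gt_eqF.
have -> : (Num.sqrt r + Num.sqrt s / n) ^+ 2 =
    r + s / n ^+ 2 + 2 * (Num.sqrt r * Num.sqrt s) / n.
  by rewrite sqrrD expr_div_n !sqr_sqrtr//; ring.
by rewrite lerD2l -!(mulrA 2) ler_pM2l// ler_pM2r ?invr_gt0.
Qed.

(** The function f(y) = r^y + c s^y is convex, f(0) = 1 + c and f(1) <= 1.  For
    y <= 1/2, the point 1/2 lies between y and 1, so f(y) < 1 would force
    f(1/2) < 1.  For y > 1/2, it lies between 0 and y, and the weight of f(0)
    in this convex combination is 1 - 1/(2y), which is at most 1/28 exactly
    when y <= 14/27: this is what the margin c/28 pays for. *)
Lemma two_powers_ge1 (R : realType) (r s c y : R) :
  0 < r -> 0 < s -> 0 < c -> 0 < y <= 14 / 27 ->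
  r + s * c <= 1 -> 1 + c / 28 <= r `^ 2^-1 + s `^ 2^-1 * c ->
  1 <= r `^ y + s `^ y * c.
Proof.
move=> r0 s0 c0 /andP[y0 y1] at1 athalf.
have conv u v t : 0 <= t <= 1 ->
    r `^ (t * u + (1 - t) * v) + s `^ (t * u + (1 - t) * v) * c <=
    t * (r `^ u + s `^ u * c) + (1 - t) * (r `^ v + s `^ v * c).
  move=> t01; have hr := powR_convex_exponent u v r0 t01.
  have := powR_convex_exponent u v s0 t01.
  rewrite -(ler_pM2r c0); move: hr; lra.
have [yh|hy] := leP y (2^-1).
- pose t := 2^-1 / (1 - y).
  have z0 : 0 < 1 - y by lra.
  have t0 : 0 < t <= 1.
    by rewrite /t divr_gt0 ?invr_gt0//= ler_pdivrMr// mul1r; lra.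
  have t01 : 0 <= t <= 1 by case/andP: t0 => /ltW -> ->.
  have := conv y 1 t t01.
  have -> : t * y + (1 - t) * 1 = 2^-1 by rewrite /t; field; rewrite gt_eqF.
  rewrite !powRr1 ?(ltW r0) ?(ltW s0)// => h; have {}h := le_trans athalf h.
  case/andP: t0 => t0 t1.
  set f1 := r + s * c in at1 h; set fy := r `^ y + _ in h *.
  have g : 0 <= (1 - t) * (1 - f1) by rewrite mulr_ge0 ?subr_ge0.
  by rewrite -subr_ge0 -(pmulr_rge0 _ t0); lra.
- pose t := (2 * y)^-1.
  have ty : t * y = 2^-1 by rewrite /t; field; rewrite gt_eqF.
  have t0 : 0 < t by rewrite invr_gt0; lra.
  have t1 : t <= 1 by nra.
  have := conv y 0 t; rewrite mulr0 addr0 ty !powRr0 (ltW t0) t1 => /(_ isT) h.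
  have {}h := le_trans athalf h.
  have t2 : 27 / 28 <= t by nra.
  set fy := r `^ y + _ in h *.
  have g : 0 <= (t - 27 / 28) * c by rewrite mulr_ge0 ?subr_ge0// ltW.
  by rewrite -subr_ge0 -(pmulr_rge0 _ t0); lra.
Qed.

(** The numbers B_n of the recursion.  The formula would give -1/10 at n = 0,
    where the recursion has to start from 0. *)
Definition weight (R : realType) (n : nat) : R :=
  if n is 0 then 0 else (4 * n%:R - 1) / 10.

Arguments weight : simpl never.

Lemma weight_ge0 (R : realType) n : 0 <= weight R n.
Proof.
case: n => [|n]; rewrite /weight// -natr1; have : (0 : R) <= n%:R by []; lra.
Qed.

Lemma weight_step (R : realType) (y : R) (n : nat) : 0 < y <= 14 / 27 ->
  (weight R n.+1 + 1) `^ y <=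
  weight R n `^ y + (13 / 10) `^ y * n.+1%:R `^ (y - 1).
Proof.
case: n => [|n] y01; have /andP[y0 _] := y01.
  (* An equality, since the first weight is 3/10 = K - 1. *)
  rewrite /weight powR0 ?gt_eqF// add0r powR1 mulr1.
  by rewrite (_ : (_ - _) / _ + 1 = 13 / 10 :> R)//; lra.
rewrite /weight; set m : R := n.+2%:R.
have m2 : 2 <= m by rewrite ler_nat.
have -> : n.+1%:R = m - 1 :> R by rewrite /m -[in RHS]natr1 addrK.
have m0 : 0 < m by lra.
pose A := (4 * m + 9) / 10; have A0 : 0 < A by rewrite /A; lra.
have -> : (4 * m - 1) / 10 + 1 = A by rewrite /A; lra.
have d0 : 0 < 4 * m + 9 by lra.
have B0 : 0 < 4 * m - 5 by lra.
have rB : (4 * m - 5) / (4 * m + 9) = (4 * (m - 1) - 1) / 10 / A.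
  by rewrite /A; field; rewrite gt_eqF.
have sB : 13 * m / (4 * m + 9) = 13 / 10 * m / A.
  by rewrite /A; field; rewrite gt_eqF.
have key : 1 <= ((4 * m - 5) / (4 * m + 9)) `^ y +
    (13 * m / (4 * m + 9)) `^ y * m^-1.
  apply: two_powers_ge1 => //.
  - exact: divr_gt0.
  - by apply: divr_gt0 => //; exact: mulr_gt0.
  - by rewrite invr_gt0.
  - have -> : (4 * m - 5) / (4 * m + 9) + 13 * m / (4 * m + 9) / m =
        (4 * m + 8) / (4 * m + 9) by field; rewrite !gt_eqF.
    by rewrite ler_pdivrMr//; lra.
  - rewrite !powR12_sqrt ?divr_ge0 ?mulr_ge0 ?(ltW B0) ?(ltW m0) ?(ltW d0)//.
    by have := sqrt_weights_ge m2; rewrite mul1r mulrC.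
have mB0 : 0 < 4 * (m - 1) - 1 by lra.
move: key; rewrite rB sB -(ler_pM2r (powR_gt0 y A0)) mul1r => /le_trans; apply.
have B1 : 0 <= (4 * (m - 1) - 1) / 10 / A by rewrite !divr_ge0// ltW.
have s1 : 0 <= 13 / 10 * m / A by rewrite divr_ge0 ?mulr_ge0 ?divr_ge0// ltW.
rewrite mulrDl [_ * m^-1 * _]mulrAC -!powRM ?(ltW A0)//.
rewrite !mulfVK ?gt_eqF// [(13 / 10 * m) `^ y]powRM ?(ltW m0) ?divr_ge0// -mulrA.
by rewrite powRB ?powRr1 ?(ltW m0)// (gt_eqF m0) implybT.
Qed.

(** * Admissibility of the constant *)

(** Here [a] and [T] are indexed from 0, so that [T n] stands for T_(n+1) in the
    usual numbering.  The leftover [weight R N `^ p^-1 * T N `^ q^-1] is what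
    makes the induction on N go through: Hoelder's inequality turns the new
    term of [a] and the new leftover into a multiple of [T N `^ q^-1], which
    [weight_step] splits into the old leftover and the new right-hand term. *)
Lemma partial_sum_bound (R : realType) (q p : R) (a T : nat -> R) (N : nat) :
  0 < q -> 27 / 14 <= p -> q^-1 + p^-1 = 1 ->
  (forall n, 0 <= a n) -> (forall n, 0 <= T n) ->
  (forall n, T n = a n `^ q + T n.+1) ->
  \sum_(0 <= n < N) a n + weight R N `^ p^-1 * T N `^ q^-1 <=
  (13 / 10) `^ p^-1 * \sum_(0 <= n < N) (n.+1%:R^-1 * T n) `^ q^-1.
Proof.
move=> q0 p2 pq a0 T0 TS.
have p0 : 0 < p by lra.
have y01 : 0 < p^-1 <= 14 / 27.
  rewrite invr_gt0 p0 -[14 / 27]invrK lef_pV2 ?posrE ?invf_div//; lra.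
elim: N => [|N IH].
  by rewrite !big_nil mulr0 /weight powR0 ?mul0r ?addr0// invr_eq0 gt_eqF.
rewrite !big_nat_recr//= mulrDr.
have two_term : a N + weight R N.+1 `^ p^-1 * T N.+1 `^ q^-1 <=
    (weight R N.+1 + 1) `^ p^-1 * T N `^ q^-1.
  have := @hoelder2 R 1 (weight R N.+1 `^ p^-1) (a N) (T N.+1 `^ q^-1) p q.
  rewrite mul1r -!powRrM !mulVf ?gt_eqF// !powRr1 ?weight_ge0// powR1 -TS [1 + _]addrC.
  by apply; rewrite ?powR_ge0 1?addrC.
have := ler_wpM2r (powR_ge0 (T N) q^-1) (weight_step N y01).
have -> : p^-1 - 1 = - q^-1 by lra.
have -> : (N.+1%:R^-1 * T N) `^ q^-1 = N.+1%:R `^ (- q^-1) * T N `^ q^-1.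
  by rewrite powRM ?invr_ge0// -powR_inv1// -powRrM mulN1r.
move: two_term IH; lra.
Qed.

Lemma tail_inequality_of_partial_sums (R : realType) (q C : R) (a : nat -> R) :
  0 <= C -> (forall n, (1 <= n)%N -> 0 <= a n) ->
  (forall N, (\sum_(1 <= n < N) (a n)%:E <= C%:E *
     \sum_(1 <= n < N) ((n%:R^-1)%:E * \sum_(n <= k <oo) (a k `^ q)%:E) `^ q^-1)%E) ->
  tail_inequality q C a.
Proof.
move=> C0 a0 h; apply: lime_le.
  by apply: is_cvg_nneseries => n n1 _; rewrite lee_fin a0.
apply: nearW => N; apply: le_trans (h N) _.
apply: lee_wpmul2l; first by rewrite lee_fin.
by apply: nneseries_lim_ge => n _ _; exact: poweR_ge0.
Qed.

Lemma powR_13_10_admissible (R : realType) (q p : R) :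
  0 < q -> 27 / 14 <= p -> q^-1 + p^-1 = 1 ->
  admissible_constants q ((13 / 10) `^ p^-1).
Proof.
move=> q0 p2 pq; have K0 : 0 < (13 / 10) `^ p^-1 :> R by rewrite powR_gt0; lra.
split => // a a0 aq.
pose b k := (a k `^ q)%:E.
have b0 k : (0 <= b k)%E by rewrite lee_fin powR_ge0.
pose T n := (\sum_(n <= k <oo) b k)%E.
have T0 n : (0 <= T n)%E by apply: nneseries_ge0.
have TS n : T n = (b n + T n.+1)%E.
  by rewrite /T (nneseries_split n 1)// addn1 big_nat1.
have T1 : (T 1%N < +oo)%E.
  rewrite /T; have <- : (\sum_(1 <= n <oo) (`|a n| `^ q)%:E =
      \sum_(1 <= n <oo) b n)%E; last exact: aq.
  rewrite eseries_cond [RHS]eseries_cond; apply: eq_eseriesr => n /andP[_ n1].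
  by rewrite /b ger0_norm ?a0.
have Tfin n : T n.+1 \is a fin_num.
  rewrite ge0_fin_numE//; elim: n => // n; apply: le_lt_trans.
  by rewrite [leRHS]TS leeDr.
apply: tail_inequality_of_partial_sums => [|//|N]; first exact: ltW.
case: N => [|N]; first by rewrite !big_geq// mule0.
have := @partial_sum_bound R q p (fun n => a n.+1) (fun n => fine (T n.+1)) N
  q0 p2 pq.
have /[swap] /[apply] : forall n, 0 <= a n.+1 by move=> n; exact: a0.
have /[swap] /[apply] : forall n, 0 <= fine (T n.+1) by move=> n; rewrite fine_ge0.
have /[swap] /[apply] : forall n, fine (T n.+1) = a n.+1 `^ q + fine (T n.+2).
  by move=> n; rewrite TS fineD.
set w := _ * _ `^ _ => h.
have {}h : \sum_(0 <= n < N) a n.+1 <=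
    (13 / 10) `^ p^-1 * \sum_(0 <= n < N) (n.+1%:R^-1 * fine (T n.+1)) `^ q^-1.
  by apply: le_trans h; rewrite lerDl mulr_ge0 ?powR_ge0.
rewrite !big_add1/= -/b.
rewrite sumEFin.
under eq_bigr => n _ do
  rewrite -/(T n.+1) -(fineK (Tfin n)) -EFinM poweR_EFin.
by rewrite sumEFin -EFinM lee_fin.
Qed.

(** * The minimal constant *)

(** Both sides of the inequality can be computed for the sequence
    (1, 0, 0, ...): it reads 1 <= C. *)
Lemma admissible_ge1 (R : realType) (q C : R) :
  0 < q -> admissible_constants q C -> 1 <= C.
Proof.
move=> q0 [C0 /(_ (fun n => (n == 1)%:R))].
have q1 : q != 0 by rewrite gt_eqF.
have pw (n : nat) : ((n == 1)%:R : R) `^ q = (n == 1)%:R.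
  by case: (n == 1)%N; rewrite ?powR1 ?powR0.
have tail0 (f : nat -> \bar R) m : (forall n, (2 <= n)%N -> f n = 0%E) ->
    (2 <= m)%N -> (\sum_(m <= n <oo) f n = 0)%E.
  by move=> f0 m2; apply: eseries0 => n mn _; rewrite f0// (leq_trans m2).
have only1 (f : nat -> \bar R) : (0 <= f 1%N)%E ->
    (forall n, (2 <= n)%N -> f n = 0%E) -> (\sum_(1 <= n <oo) f n = f 1%N)%E.
  move=> f1 f0; rewrite (nneseries_split 1 1); last first.
    by move=> [|[|k]]// _; rewrite f0.
  by rewrite addn1 big_nat1 tail0// adde0.
have ell : in_ell q (fun n => (n == 1)%:R : R).
  rewrite /in_ell only1 => [||n n2]; rewrite ?normr_nat ?pw ?lee_fin ?ltry//.
  by rewrite gtn_eqF.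
move=> /(_ (fun n _ => ler0n _ _) ell).
rewrite /tail_inequality only1; [|by rewrite lee_fin|by move=> [|[|n]]].
rewrite only1 /=.
- rewrite only1 => [|/=|[|[|n]]//= _]; rewrite ?lee_fin ?powR_ge0 ?powR0//.
  by rewrite invr1 eqxx powR1 mulr1 powR1 mulr1.
- exact: poweR_ge0.
move=> n n2; rewrite tail0// ?mule0 ?poweR0r ?invr_eq0//.
by move=> [|[|k]]//= _; rewrite powR0.
Qed.

(** For a fixed sequence the inequality is closed in C.  The lower bound 1 is
    needed when the right-hand sum is infinite, because 0 * +oo = 0. *)
Lemma inf_admissible (R : realType) (q : R) :
  0 < q -> admissible_constants q !=set0 ->
  is_minimal_constant q (inf (admissible_constants q)).
Proof.
move=> q0 S0.
have lb1 : lbound (admissible_constants q) 1 by move=> C /(admissible_ge1 q0).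
have hlb : has_lbound (admissible_constants q) by exists 1.
split; last by move=> C SC; exact: ge_inf.
have i1 : 1 <= inf (admissible_constants q) by exact: lb_le_inf.
have i0 := lt_le_trans ltr01 i1.
split=> // a a0 aq.
rewrite /tail_inequality.
set X := (\sum_(1 <= n <oo) _ `^ _)%E.
have X0 : (0 <= X)%E by apply: nneseries_ge0 => n _ _; exact: poweR_ge0.
have hS C : admissible_constants q C -> (\sum_(1 <= n <oo) (a n)%:E <= C%:E * X)%E.
  by case=> _ /(_ a a0 aq).
have [->|Xy] := eqVneq X +oo%E; first by rewrite gt0_muley ?lte_fin// leey.
have Xf : X \is a fin_num by rewrite ge0_fin_numE// ltey.
move: hS; rewrite -(fineK Xf) => hS.
set x := fine X in hS *; have x0 : 0 <= x by exact: fine_ge0.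
have [xE|xN0] := eqVneq x 0.
  by case: S0 => C /hS; rewrite xE !mule0.
have xpos : 0 < x by rewrite lt_neqAle eq_sym xN0.
move: hS; set L := (\sum_(1 <= n <oo) _)%E => hS.
have L0 : (0 <= L)%E by apply: nneseries_ge0 => n n1 _; rewrite lee_fin a0.
have Lf : L \is a fin_num.
  by rewrite ge0_fin_numE//; case: S0 => C /hS /le_lt_trans; apply; rewrite ltry.
rewrite -(fineK Lf) -EFinM lee_fin -ler_pdivrMr//.
apply: lb_le_inf => // C /hS; rewrite -(fineK Lf) -EFinM lee_fin.
by rewrite ler_pdivrMr.
Qed.

Theorem theorem2p7 (R : realType) (q q' : R)
  (hq1 : 1 < q) (hq2 : q <= (2 + ln 2) / (2 - ln 2))
  (hq' : q' = q / (q - 1)) :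
  exists C1 : R, is_minimal_constant q C1 /\
    C1 <= (expR 1 * ln 2 / Num.sqrt 2) `^ (1 / q').
Proof.
have q0 : 0 < q by lra.
have x2 := ln2_le R.
have p2 : 27 / 14 <= q'.
  have d0 : 0 < 2 - ln 2 :> R by lra.
  move: hq2; rewrite ler_pdivlMr// hq' ler_pdivlMr ?subr_gt0// => h.
  nra.
have pq : q^-1 + q'^-1 = 1.
  by rewrite hq'; field; rewrite !gt_eqF// subr_gt0.
have A := powR_13_10_admissible q0 p2 pq.
have M : is_minimal_constant q (inf (admissible_constants q)).
  by apply: inf_admissible => //; exists ((13 / 10) `^ q'^-1).
exists (inf (admissible_constants q)); split=> //.
apply: le_trans (M.2 _ A) _; rewrite div1r.
apply: ge0_ler_powR; rewrite ?nnegrE ?invr_ge0; last exact: constant_ge.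
- lra.
- lra.
- by apply: le_trans (constant_ge R); lra.
Qed.
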